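(* Consider a FIFO system shared by flow $1$ (the flow of interest) and flow $2$ (the aggregate of the remaining flows). The system offers a $c$-Lipschitz service curve $\beta\in\mathcal F^0_{\mathrm{inc}}$ to the aggregate of the flows, and as soon as a packet starts to be transmitted, it is transmitted with rate $c>0$. The packet lengths of flow $i$ lie in $[L_i^{\min},L_i^{\max}]$, $i=1,2$. For bit-level arrival curves $\alpha_1,\alpha_2$ of flows $1,2$, let $$\Delta^{\mathrm A}[\alpha_1,\alpha_2]=h(\alpha_1+\alpha_2-L_1^{\min},\beta)+\frac{L_1^{\min}}{c},$$ and for $g_1$- and $g_2$-regularity constraints of flows $1,2$, let $$\Delta^{\mathrm G}[g_1,g_2]=h(g_1^{\uparrow}+g_2^{\uparrow}+L_2^{\max},\beta)+\frac{L_1^{\max}}{c}.$$ These are response-time upper bounds for any packet of flow $1$. 1. Assume that the flows have bit-level arrival curves $\alpha_1,\alpha_2$, and let $g_i(x)=\alpha_i^{\downarrow}(x+L_i^{\min})$ for $x>0$, $g_i(0)=0$, be the derived regularity constraints. Then the bound obtained directly from the arrival curves is at least as good as the one obtained from the derived regularity constraints: $\Delta^{\mathrm A}[\alpha_1,\alpha_2]\le\Delta^{\mathrm G}[g_1,g_2]$. Furthermore, if the packets of flow $1$ have a constant size ($L_1^{\min}=L_1^{\max}$), then $\Delta^{\mathrm A}[\alpha_1,\alpha_2]=\Delta^{\mathrm G}[g_1,g_2]$; else $\Delta^{\mathrm A}[\alpha_1,\alpha_2]<\Delta^{\mathrm G}[g_1,g_2]$ in general. 2. Assume that the flows have $g_1$-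 and $g_2$-regularity constraints, and let $\alpha_i(t)=g_i^{\downarrow}(t)+L_i^{\max}$ for $t>0$, $\alpha_i(0)=0$, be the derived bit-level arrival curves. Then the bound obtained directly from the regularity constraints is at least as good as the one obtained from the derived arrival curves: $\Delta^{\mathrm G}[g_1,g_2]\le\Delta^{\mathrm A}[\alpha_1,\alpha_2]$. Furthermore, if the packets of flow $1$ have a constant size ($L_1^{\min}=L_1^{\max}$), then $\Delta^{\mathrm A}[\alpha_1,\alpha_2]=\Delta^{\mathrm G}[g_1,g_2]$; else $\Delta^{\mathrm G}[g_1,g_2]<\Delta^{\mathrm A}[\alpha_1,\alpha_2]$ in general. Here ''in general'' means that there are schedulers (service curves $\beta$) for which the inequality is strict, for example a rate-latency service curve $\beta(t)=R\max(t-T,0)$ with $R<c$.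
   Context: $\mathcal F^0_{\mathrm{inc}}$ is the set of wide-sense increasing functions $w:[0,\infty)\to[0,\infty]$ with $w(0)=0$. Pseudo-inverses: $w^{\downarrow}(x)=\inf\{s\ge 0: w(s)\ge x\}$ and $w^{\uparrow}(x)=\sup\{s\ge0:w(s)\le x\}$. The horizontal deviation from $w'$ to $w$ is $h(w',w)=\sup_{t\ge 0}\{w^{\downarrow}(w'(t))-t\}$. A function $w$ is $c$-Lipschitz if $|w(t_2)-w(t_1)|\le c|t_2-t_1|$ for all $t_1,t_2\ge0$. Packets are stored in a queue and served in FIFO order without preemption. All bits of a packet arrive at the same instant. The response time of a packet is the time from its arrival to the end of its transmission. Let $\mathcal A(t)$ and $\mathcal D(t)$ be the cumulative numbers of bits that have arrived in, respectively departed from, the system until time $t$ (excluded). The system offers service curve $\beta$ if for every $t\ge0$ there exists $s\le t$ with $\mathcal D(t)\ge\beta(t-s)+\mathcal A(s)$. A flow has bit-level arrival curve $\alpha\in\mathcal F^0_{\mathrm{inc}}$ if the number of bits of the flow arriving in any interval $[s,t)$ is at most $\alpha(t-s)$. Here $\alpha$ is assumed left-continuous, and its right limit at $0$ is assumed at least the flow's maximum packet length. A flow satisfies a $g$-regularity constraint, with $g\in\mathcal F^0_{\mathrm{inc}}$ left-continuous, if its packets, numbered in order of arrival with arrival times $A_n$ and lengths $l_n$, satisfy $A_n-A_m\ge g\big(\sum_{k=m}^{n-1}l_k\big)$ for all $m\le n$.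
   Formalization: In item 1 the equality is stated only when flow 2 also has constant packet size (L_2^min = L_2^max), as it fails otherwise for finite bounds; that the two quantities bound the response time is taken as background and not proved. *)

(* Defs.v *)
(* World: MathComp-Analysis.  Functions on [0, +oo) are maps [R -> \bar R] whose
   values at negative arguments are never used. *)
From mathcomp Require Import all_boot all_order all_algebra.
From mathcomp Require Import all_classical all_reals all_analysis.

Set Implicit Arguments.
Unset Strict Implicit.
Unset Printing Implicit Defensive.

Import Order.TTheory GRing.Theory Num.Theory.
Import numFieldNormedType.Exports.

Local Open Scope classical_set_scope.
Local Open Scope ring_scope.
Local Open Scope ereal_scope.

Section Functions.
Context {R : realType}.
Implicit Types (w : R -> \bar R) (c L t : R).

Definition F0inc w : Prop :=
  [/\ w 0%R = 0,
      forall t, (0 <= t)%R -> 0 <= w t &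
      forall s t, (0 <= s)%R -> (s <= t)%R -> w s <= w t].

Definition left_continuous w : Prop :=
  forall t, (0 < t)%R -> w s @[s --> t^'-] --> w t.

(* In [\bar R], [`|+oo - +oo| = +oo], so an infinite value refutes this. *)
Definition lipschitz_curve c w : Prop :=
  forall t1 t2, (0 <= t1)%R -> (0 <= t2)%R ->
    `|w t2 - w t1| <= (c * `|t2 - t1|)%:E.

(* The argument is extended-real, since these are applied to values of curves;
   [ereal_inf set0 = +oo]. *)
Definition pinv_down w (x : \bar R) : \bar R :=
  ereal_inf [set s%:E | s in [set s : R | (0 <= s)%R /\ x <= w s]].

Definition pinv_up w (x : \bar R) : \bar R :=
  ereal_sup [set s%:E | s in [set s : R | (0 <= s)%R /\ w s <= x]].

Definition hdev (w' w : R -> \bar R) : \bar R :=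
  ereal_sup [set pinv_down w (w' t) - t%:E | t in [set t : R | (0 <= t)%R]].

Definition rate_latency (r T : R) : R -> \bar R :=
  fun t => (r * Num.max (t - T) 0)%:E.

Definition derived_regularity L (a : R -> \bar R) : R -> \bar R :=
  fun x => if (0 < x)%R then pinv_down a (x + L)%:E else 0.

Definition derived_arrival L (g : R -> \bar R) : R -> \bar R :=
  fun t => if (0 < t)%R then pinv_down g t%:E + L%:E else 0.

Definition DeltaA c (L1min : R) (beta a1 a2 : R -> \bar R) : \bar R :=
  hdev (fun t => a1 t + a2 t - L1min%:E) beta + (L1min / c)%:E.

Definition DeltaG c (L1max L2max : R) (beta g1 g2 : R -> \bar R) : \bar R :=
  hdev (fun t => pinv_up g1 t%:E + pinv_up g2 t%:E + L2max%:E) beta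
    + (L1max / c)%:E.

End Functions.

Definition flow1 : bool := true.
Definition flow2 : bool := false.

(* The packets of both flows are numbered jointly, in FIFO order; [packet] is the
   set of numbers in use (an initial segment of [nat], finite or not). *)
Record trace (R : realType) := Trace {
  packet : set nat;
  flow : nat -> bool;
  arrival : nat -> R;
  len : nat -> R;
  start : nat -> R  (* beginning of the transmission *)
}.

Section System.
Context {R : realType}.
Implicit Types (S : trace R) (i : bool) (c : R) (Lmin Lmax : bool -> R).

Definition fifo_trace c Lmin Lmax S : Prop :=
  [/\ forall m n, (m <= n)%N -> packet S n -> packet S m,
      forall n, packet S n ->
        (Lmin (flow S n) <= len S n <= Lmax (flow S n))%R,
      forall n, packet S n -> (0 <= arrival S n <= start S n)%R,
      forall n, packet S n.+1 -> (arrival S n <= arrival S n.+1)%R &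
      forall n, packet S n.+1 -> (start S n + len S n / c <= start S n.+1)%R].

(* Bits are counted individually on departure: packet [n] leaves at rate [c] from
   [start S n] on. *)
Definition arrived S (t : R) : \bar R :=
  \esum_(n in [set n | packet S n /\ (arrival S n < t)%R]) (len S n)%:E.

Definition departed c S (t : R) : \bar R :=
  \esum_(n in packet S)
    (Num.min (len S n) (c * Num.max (t - start S n) 0))%:E.

Definition service_curve c S (beta : R -> \bar R) : Prop :=
  forall t : R, (0 <= t)%R ->
    exists s : R, (0 <= s <= t)%R /\
      beta (t - s)%R + arrived S s <= departed c S t.

Definition fifo_system c Lmin Lmax S (beta : R -> \bar R) : Prop :=
  [/\ fifo_trace c Lmin Lmax S, F0inc beta, lipschitz_curve c beta &
      service_curve c S beta].

Definition arrived_between S i (s t : R) : \bar R :=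
  \esum_(n in [set n | [/\ packet S n, flow S n = i &
                           (s <= arrival S n < t)%R]]) (len S n)%:E.

Definition arrival_curve Lmax S i (a : R -> \bar R) : Prop :=
  [/\ F0inc a, left_continuous a, (Lmax i)%:E <= lim (a t @[t --> 0^'+]) &
      forall s t : R, (0 <= s)%R -> (s <= t)%R ->
        arrived_between S i s t <= a (t - s)%R].

(* The joint numbering is monotone in that of each flow, so the sum over the
   packets [k] of flow [i] with [m <= k < n] is the sum in the flow's own
   numbering. *)
Definition regularity S i (g : R -> \bar R) : Prop :=
  [/\ F0inc g, left_continuous g &
      forall m n, (m <= n)%N -> packet S n -> flow S m = i -> flow S n = i ->
        g (\sum_(m <= k < n | flow S k == i) len S k)%R
          <= (arrival S n - arrival S m)%:E].

End System.

(* Main.v *)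
(** For a derived regularity constraint, [g^up (t) + Lmin] is the right limit of
    the arrival curve at [t]; for a derived arrival curve, [alpha (t)] is
    [g^down (t) + Lmax], and [g^up] is the right limit of [g^down].  A horizontal
    deviation does not distinguish a curve from its right limit, since the
    deviation at [t] exceeds the one at [t + e] by at most [e] as the curve
    increases.  So in part 1 the deviations compare directly, and the terms
    [L / c] make the bound strict.  In part 2, with [d = L1max - L1min], the
    curve under [Delta^A] is the one under [Delta^G] raised by [d]; as
    [beta^down (x + d) >= beta^down x + d / k] for a [k]-Lipschitz [beta], taking
    [k = c] gives the inequality, and taking [k = r < c] for a rate-latency curve
    makes it strict.  A single packet of flow 1 sent at time 0 realizes the
    hypotheses with finite bounds. *)
Require Import Defs.
From mathcomp Require Import all_boot all_order all_algebra.
From mathcomp Require Import all_classical all_reals all_analysis.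
From mathcomp Require Import ring lra.
Import Order.TTheory GRing.Theory Num.Theory.
Import numFieldNormedType.Exports.
Local Open Scope classical_set_scope.
Local Open Scope ring_scope.
Local Open Scope ereal_scope.

Section Curves.
Context {R : realType}.
Implicit Types (w b a g : R -> \bar R) (x y : \bar R) (s t L c d r T M : R).

Lemma le_pinv_down w x y : x <= y -> pinv_down w x <= pinv_down w y.
Proof.
move=> xy; apply: ereal_inf_le_tmp => _ [s [s0 ys] <-].
by exists s => //; split => //; exact: le_trans ys.
Qed.

Lemma pinv_down_ge0 w x : 0 <= pinv_down w x.
Proof. by apply: le_ereal_inf_tmp => _ [s [s0 _] <-]; rewrite lee_fin. Qed.

Lemma pinv_down_le w x s : (0 <= s)%R -> x <= w s -> pinv_down w x <= s%:E.
Proof. by move=> s0 xs; apply: ereal_inf_lbound; exists s. Qed.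

Lemma pinv_up_ge w x s : (0 <= s)%R -> w s <= x -> s%:E <= pinv_up w x.
Proof. by move=> s0 sx; apply: ereal_sup_ubound; exists s. Qed.

Lemma pinv_up_ge0 w x : w 0%R = 0 -> 0 <= x -> 0 <= pinv_up w x.
Proof. by move=> w0 x0; apply: pinv_up_ge; rewrite ?w0. Qed.

Lemma pinv_down_le_up w x : w 0%R = 0 -> 0 <= x -> pinv_down w x <= pinv_up w x.
Proof.
move=> w0 x0; have := pinv_up_ge0 w x w0 x0.
case E: (pinv_up w x) => [u| |] // u0; last by rewrite leey.
apply/lee_addgt0Pr => e e0.
have ue0 : (0 <= u + e)%R by rewrite addr_ge0// ltW.
apply: pinv_down_le => //; rewrite leNgt; apply/negP => /ltW /(pinv_up_ge _ _ _ ue0).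
by rewrite E lee_fin gerDl leNgt e0.
Qed.

Lemma pinv_up_le_down w x y :
  F0inc w -> x < y -> pinv_up w x <= pinv_down w y.
Proof.
case=> _ _ wm xy; apply: ge_ereal_sup => _ [s [s0 sx] <-].
apply: le_ereal_inf_tmp => _ [u [u0 yu] <-]; rewrite lee_fin leNgt.
apply/negP => us; have := lt_le_trans (le_lt_trans sx xy) yu.
by rewrite ltNge wm// ltW.
Qed.

Lemma le_hdev w w' b :
  (forall t, (0 <= t)%R -> w t <= w' t) -> hdev w b <= hdev w' b.
Proof.
move=> ww'; apply: ge_ereal_sup => _ [t t0 <-].
apply: le_trans (ereal_sup_ubound _); last by exists t.
by rewrite leeD2r// le_pinv_down// ww'.
Qed.

(* Letting [t'] decrease to [t] absorbs the difference between a curve and its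
   right limit. *)
Lemma hdev_gap w w' b d :
  (forall t t', (0 <= t)%R -> (t < t')%R ->
     pinv_down b (w t) + d%:E <= pinv_down b (w' t')) ->
  hdev w b + d%:E <= hdev w' b.
Proof.
move=> ww'; rewrite -leeBrDr//; apply: ge_ereal_sup => _ [t t0 <-].
rewrite leeBrDr//; apply/lee_addgt0Pr => e e0.
have tt' : (t < t + e)%R by rewrite ltrDl.
rewrite addeAC leeBlDr//; apply: (le_trans (ww' _ _ t0 tt')).
rewrite -addeA -EFinD (addrC e) -leeBlDr//.
by apply: ereal_sup_ubound; exists (t + e)%R => //=; apply: addr_ge0 => //; exact: ltW.
Qed.

Lemma hdev_ge0 w b : 0 <= hdev w b.
Proof.
apply: le_trans (ereal_sup_ubound _); last by exists 0%R => /=.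
by rewrite sube0 pinv_down_ge0.
Qed.

Lemma lipschitz_curve_fin_num c b t :
  b 0%R = 0 -> lipschitz_curve c b -> (0 <= t)%R -> b t \is a fin_num.
Proof.
move=> b0 lb t0; have := lb 0%R t (lexx _) t0.
by rewrite b0 sube0 fin_num_abs => /le_lt_trans; apply; exact: ltry.
Qed.

Lemma lipschitz_curve_le c b s t :
  b 0%R = 0 -> lipschitz_curve c b -> (0 <= s)%R -> (s <= t)%R ->
  b t <= b s + (c * (t - s))%:E.
Proof.
move=> b0 lb s0 st; have t0 := le_trans s0 st.
have := lb s t s0 t0.
rewrite -leeBlDl ?(lipschitz_curve_fin_num c)// (@ger0_norm _ (t - s)%R) ?subr_ge0//.
by apply: le_trans; exact: lee_abs.
Qed.

Lemma lipschitz_pinv_down c b x d :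
  (0 < c)%R -> b 0%R = 0 -> lipschitz_curve c b -> 0 <= x -> (0 <= d)%R ->
  pinv_down b x + (d / c)%:E <= pinv_down b (x + d%:E).
Proof.
move=> c0 b0 lb x0 d0; apply: le_ereal_inf_tmp => _ [s [s0 xs] <-].
have ds : (0 <= s - d / c)%R.
  have := le_trans xs (lipschitz_curve_le c b 0 s b0 lb (lexx _) s0).
  rewrite b0 add0e subr0 => xcs.
  have : d%:E <= (c * s)%:E by apply: le_trans xcs; rewrite leeDr.
  by rewrite lee_fin subr_ge0 ler_pdivrMr// mulrC.
rewrite -leeBrDr// -EFinB; apply: pinv_down_le => //.
have sds : (s - d / c <= s)%R by rewrite gerBl divr_ge0// ltW.
have := lipschitz_curve_le c b _ s b0 lb ds sds.
rewrite (_ : c * (s - (s - d / c)) = d)%R; last by field; rewrite gt_eqF.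
by move/(le_trans xs); rewrite leeD2rE.
Qed.

Lemma lim_at_right_le a t :
  F0inc a -> (0 < t)%R -> lim (a s @[s --> 0%R^'+]) <= a t.
Proof.
case=> _ _ am t0.
have /cvg_lim -> // : a s @[s --> 0%R^'+] -->
    ereal_inf (a @` [set` Interval (BRight 0%R) (BInfty R false)]).
  apply: nondecreasing_at_right_cvge => // x y; rewrite !in_itv/= !andbT.
  by move=> x0 y0 xy; apply: am => //; exact: ltW.
by apply: ereal_inf_lbound; exists t => //=; rewrite in_itv/= t0.
Qed.

Lemma le_pinv_up_derived_regularity L a t :
  (0 <= L)%R -> (0 <= t)%R ->
  a t <= pinv_up (derived_regularity L a) t%:E + L%:E.
Proof.
move=> L0 t0; set g := derived_regularity L a.
have g00 : g 0%R = 0 by rewrite /g /derived_regularity ltxx.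
have below z : (0 < z)%R -> (z + L)%:E <= a t -> z%:E <= pinv_up g t%:E.
  move=> z0 zat; apply: pinv_up_ge; first exact: ltW.
  by rewrite /g /derived_regularity z0; exact: pinv_down_le.
case E: (a t) => [r| |]; last by rewrite leNye.
- have [rL|Lr] := leP r L.
    by rewrite (@le_trans _ _ L%:E) ?lee_fin// leeDr// pinv_up_ge0// lee_fin.
  by rewrite -leeBlDr// -EFinB below ?subr_gt0// subrK E.
- suff /eqyP -> : forall z, (0 < z)%R -> z%:E <= pinv_up g t%:E by [].
  by move=> z z0; apply: below; rewrite // E leey.
Qed.

Lemma pinv_up_derived_regularity_le L a t t' :
  F0inc a -> L%:E <= lim (a s @[s --> 0%R^'+]) -> (0 <= t)%R -> (t < t')%R ->
  pinv_up (derived_regularity L a) t%:E + L%:E <= a t'.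
Proof.
move=> aF La t0 tt'; have t'0 := le_lt_trans t0 tt'.
rewrite -leeBrDr//; apply: ge_ereal_sup => y [x [x0]].
rewrite /derived_regularity; case: ifPn => [_|]; last first.
  move=> x_le0 _ <-; have -> : x = 0%R by apply/le_anti; rewrite x0 andbT leNgt.
  by rewrite leeBrDr// add0e (le_trans La)// lim_at_right_le.
move=> /le_lt_trans /(_ (_ : t%:E < t'%:E)); rewrite lte_fin => /(_ tt').
move=> /ereal_inf_lt[_ [s [s0 xs] <-]]; rewrite lte_fin => st' <-.
rewrite leeBrDr// -EFinD (le_trans xs)//; case: aF => _ _; apply => //.
exact: ltW.
Qed.

Lemma hdev_arrival_le L1 L2 L2' b a1 a2 :
  (0 <= L1)%R -> (0 <= L2 <= L2')%R ->
  hdev (fun t => a1 t + a2 t - L1%:E) b <=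
  hdev (fun t => pinv_up (derived_regularity L1 a1) t%:E +
                 pinv_up (derived_regularity L2 a2) t%:E + L2'%:E) b.
Proof.
move=> L10 /andP[L20 L22']; apply: le_hdev => t t0; rewrite leeBlDr//.
rewrite -addeA (addeC L2'%:E) addeACA; apply: leeD.
  exact: le_pinv_up_derived_regularity.
apply: (le_trans (le_pinv_up_derived_regularity _ _ _ L20 t0)).
by rewrite leeD2l// lee_fin.
Qed.

Lemma hdev_derived_regularity_le L1 L2 b a1 a2 :
  F0inc a1 -> L1%:E <= lim (a1 s @[s --> 0%R^'+]) ->
  F0inc a2 -> L2%:E <= lim (a2 s @[s --> 0%R^'+]) ->
  hdev (fun t => pinv_up (derived_regularity L1 a1) t%:E +
                 pinv_up (derived_regularity L2 a2) t%:E + L2%:E) b <=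
  hdev (fun t => a1 t + a2 t - L1%:E) b.
Proof.
move=> F1 La1 F2 La2; rewrite -[leLHS]adde0; apply: hdev_gap => t t' t0 tt'.
rewrite adde0; apply: le_pinv_down; rewrite leeBrDr//.
rewrite -addeA (addeC L2%:E) addeACA.
by apply: leeD; exact: pinv_up_derived_regularity_le.
Qed.

Lemma hdev_regularity_gap L1 L1' L2 d b g1 g2 :
  F0inc g1 -> F0inc g2 -> (0 <= L2)%R ->
  (forall x, 0 <= x ->
     pinv_down b x + d%:E <= pinv_down b (x + (L1' - L1)%:E)) ->
  hdev (fun t => pinv_up g1 t%:E + pinv_up g2 t%:E + L2%:E) b + d%:E <=
  hdev (fun t => derived_arrival L1' g1 t + derived_arrival L2 g2 t - L1%:E) b.
Proof.
move=> F1 F2 L20 bd; apply: hdev_gap => t t' t0 tt'.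
have [[g10 _ _] [g20 _ _]] := (F1, F2).
have t'0 := le_lt_trans t0 tt'.
apply: (le_trans (bd _ _)).
  by rewrite !adde_ge0// pinv_up_ge0// lee_fin.
apply: le_pinv_down; rewrite EFinB addeA leeD2r//.
rewrite /derived_arrival t'0 -addeA (addeC L2%:E) addeACA.
by apply: leeD; rewrite leeD2r// pinv_up_le_down// lte_fin.
Qed.

Lemma hdev_derived_arrival_le L1 L2 b g1 g2 :
  b 0%R = 0 -> g1 0%R = 0 -> g2 0%R = 0 -> (0 <= L1)%R ->
  hdev (fun t => derived_arrival L1 g1 t + derived_arrival L2 g2 t - L1%:E) b <=
  hdev (fun t => pinv_up g1 t%:E + pinv_up g2 t%:E + L2%:E) b.
Proof.
move=> b0 g10 g20 L10; apply: ge_ereal_sup => _ [t t0 <-].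
have [->|t_neq0] := eqVneq t 0%R.
  rewrite sube0 (le_trans _ (hdev_ge0 _ _))//; apply: pinv_down_le => //.
  by rewrite b0 leeBlDr// /derived_arrival ltxx !add0e lee_fin.
have t_gt0 : (0 < t)%R by rewrite lt_def t_neq0.
apply: le_trans (ereal_sup_ubound _); last by exists t.
rewrite leeD2r// le_pinv_down// leeBlDr// /derived_arrival t_gt0.
rewrite -[leRHS]addeA (addeC L2%:E) addeACA.
by apply: leeD2r; apply: leeD; apply: pinv_down_le_up; rewrite ?lee_fin.
Qed.

Definition step_curve x : R -> \bar R := fun t => if (0 < t)%R then x else 0.

Lemma step_curve_F0inc x : 0 <= x -> F0inc (step_curve x).
Proof.
move=> x0; split; first by rewrite /step_curve ltxx.
- by move=> t _; rewrite /step_curve; case: ifP.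
- move=> s t s0 st; rewrite /step_curve; case: ifPn => [/lt_le_trans -> //|_].
  by case: ifP.
Qed.

Lemma step_curve_left_continuous x : left_continuous (step_curve x).
Proof.
move=> t t0; apply: cvg_near_cst; near=> s.
rewrite /step_curve t0 ifT//; near: s; exact: nbhs_left_gt.
Unshelve. all: by end_near. Qed.

Lemma step_curve_lim x : lim (step_curve x s @[s --> 0%R^'+]) = x.
Proof.
apply: cvg_lim => //; apply: cvg_near_cst; near=> s.
by rewrite /step_curve ifT//; near: s; exact: nbhs_right_gt.
Unshelve. all: by end_near. Qed.

Lemma step_curve_le x t : 0 <= x -> step_curve x t <= x.
Proof. by rewrite /step_curve; case: ifP. Qed.

Lemma pinv_up_step_pinfty t : pinv_up (step_curve +oo) t%:E <= 0.
Proof.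
apply: ge_ereal_sup => _ [s [s0 + <-]]; rewrite /step_curve lee_fin.
by case: ltP => // _; rewrite leye_eq.
Qed.

Lemma rate_latency_F0inc r T :
  (0 <= r)%R -> (0 <= T)%R -> F0inc (rate_latency r T).
Proof.
move=> r0 T0; split.
- by rewrite /rate_latency max_r ?mulr0// sub0r oppr_le0.
- by move=> t _; rewrite lee_fin mulr_ge0// le_max lexx orbT.
- by move=> s t _ st; rewrite lee_fin ler_wpM2l// le_max2// lerD2r.
Qed.

Lemma rate_latency_lipschitz r T c :
  (0 <= r <= c)%R -> lipschitz_curve c (rate_latency r T).
Proof.
move=> /andP[r0 rc] t1 t2 _ _; rewrite -EFinB abse_EFin lee_fin -mulrBr normrM.
rewrite ger0_norm//; apply: ler_pM => //.
have [] := leP (t2 - T)%R 0%R; have [] := leP (t1 - T)%R 0%R => h1 h2;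
  have [] := ger0P (t2 - t1)%R => h3; rewrite ler_norml; lra.
Qed.

Lemma hdev_rate_latency_lt r T w M :
  (0 < r)%R -> (0 <= T)%R -> (0 <= M)%R ->
  (forall t, (0 <= t)%R -> w t <= M%:E) -> hdev w (rate_latency r T) < +oo.
Proof.
move=> r0 T0 M0 wM; apply: (@le_lt_trans _ _ (T + M / r)%:E); last exact: ltry.
have Mr0 : (0 <= M / r)%R by rewrite divr_ge0// ltW.
apply: ge_ereal_sup => _ [t t0 <-].
rewrite leeBlDr//; apply: (@le_trans _ _ (T + M / r)%:E); last by rewrite leeDl.
apply: pinv_down_le; first exact: addr_ge0.
rewrite (le_trans (wM _ t0))// lee_fin addrAC subrr add0r max_l//.
by rewrite mulrC divfK// gt_eqF.
Qed.

Definition single_packet (l : R) : trace R :=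
  Trace [set 0%N] (fun=> flow1) (fun=> 0%R) (fun=> l) (fun=> 0%R).

Lemma single_packet_fifo_system c Lmin Lmax r T :
  (0 < c)%R -> (0 <= Lmin flow1 <= Lmax flow1)%R -> (0 < r < c)%R ->
  (0 <= T)%R ->
  fifo_system c Lmin Lmax (single_packet (Lmax flow1)) (rate_latency r T).
Proof.
move=> c0 /andP[Lm0 LmM] /andP[r0 rc] T0.
have l0 := le_trans Lm0 LmM.
split.
- split => //=.
  + by move=> m n + n0; rewrite n0 leqn0 => /eqP.
  + by move=> n _; rewrite LmM lexx.
  + by move=> n _; rewrite lexx.
- by apply: rate_latency_F0inc => //; exact: ltW.
- by apply: rate_latency_lipschitz; rewrite !ltW.
- move=> t t0.
  have -> : departed c (single_packet (Lmax flow1)) t =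
            (Num.min (Lmax flow1) (c * t))%:E.
    rewrite /departed esum_set1 /= subr0 max_l// lee_fin le_min l0/=.
    by rewrite mulr_ge0// ltW.
  have [ctl|lct] := leP (c * t)%R (Lmax flow1).
  + exists 0%R; split; first by rewrite lexx.
    rewrite /arrived (_ : [set n | _] = set0); last first.
      by apply/seteqP; split => // n [_] /=; rewrite ltxx.
    rewrite esum_set0 adde0 subr0 lee_fin.
    apply: ler_pM; [exact: ltW|by rewrite le_max lexx orbT|exact: ltW|].
    by rewrite ge_max t0 gerBl T0.
  + exists t; split; first by rewrite lexx t0.
    have [b0 _ _] := rate_latency_F0inc r T (ltW r0) T0.
    rewrite subrr b0 add0e.
    rewrite /arrived (_ : [set n | _] = [set 0%N]) ?esum_set1 ?lee_fin//=.
    apply/seteqP; split => [n []//|n -> /=]; split => //.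
    by rewrite ltNge; apply/negP => t_le0; move: lct; nra.
Qed.

Lemma single_packet_arrival_curve Lmax i :
  (forall i, 0 <= Lmax i)%R ->
  arrival_curve Lmax (single_packet (Lmax flow1)) i (step_curve (Lmax i)%:E).
Proof.
move=> L0; have Li0 : 0 <= (Lmax i)%:E by rewrite lee_fin.
split; rewrite ?step_curve_lim//; first exact: step_curve_F0inc.
  exact: step_curve_left_continuous.
move=> s t s0 st; rewrite /arrived_between /step_curve.
have [->|/eqP i1] := eqVneq i flow1; last first.
  rewrite (_ : [set n | _] = set0) ?esum_set0; first by case: ifP.
  by apply/seteqP; split => // n [_] /= /esym.
have [/andP[s_le0 t_gt0]|_] := boolP (s <= 0 < t)%R.
  rewrite subr_gt0 (le_lt_trans s_le0 t_gt0).
  rewrite (_ : [set n | _] = [set 0%N]) ?esum_set1 ?lee_fin//=.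
  by apply/seteqP; split => [n []//|n ->].
rewrite (_ : [set n | _] = set0) ?esum_set0; first by case: ifP; rewrite ?lee_fin.
by apply/seteqP; split => // n [].
Qed.

Lemma single_packet_regularity l i x :
  0 <= x -> regularity (single_packet l) i (step_curve x).
Proof.
move=> x0; split; first exact: step_curve_F0inc.
  exact: step_curve_left_continuous.
move=> m n + /= n0 _ _; rewrite n0 leqn0 => /eqP ->.
by rewrite big_geq// /step_curve ltxx subrr.
Qed.

Lemma hdev_fin_num w b x : 0 <= x -> hdev w b + x < +oo -> hdev w b \is a fin_num.
Proof.
move=> x0 hx; rewrite ge0_fin_numE ?hdev_ge0//.
by apply: le_lt_trans hx; rewrite leeDl.
Qed.

Lemma DeltaA_lt_DeltaG_derived c L1 L1' L2 L2' b a1 a2 :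
  (0 < c)%R -> (0 <= L1)%R -> (L1 < L1')%R -> (0 <= L2 <= L2')%R ->
  DeltaA c L1 b a1 a2 < +oo ->
  DeltaA c L1 b a1 a2 <
  DeltaG c L1' L2' b (derived_regularity L1 a1) (derived_regularity L2 a2).
Proof.
move=> c0 L10 L11' L22' /hdev_fin_num Afin; apply: lee_ltD.
- by apply: Afin; rewrite lee_fin divr_ge0// ltW.
- exact: hdev_arrival_le.
- by rewrite lte_fin ltr_pM2r ?invr_gt0.
Qed.

Lemma DeltaG_lt_DeltaA_derived c r L1 L1' L2 b g1 g2 :
  (0 < r < c)%R -> (0 <= L1)%R -> (L1 < L1')%R -> (0 <= L2)%R ->
  b 0%R = 0 -> lipschitz_curve r b -> F0inc g1 -> F0inc g2 ->
  DeltaG c L1' L2 b g1 g2 < +oo ->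
  DeltaG c L1' L2 b g1 g2 <
  DeltaA c L1 b (derived_arrival L1' g1) (derived_arrival L2 g2).
Proof.
move=> /andP[r0 rc] L10 L11' L20 b0 br F1 F2 /hdev_fin_num Gfin.
have c0 := lt_trans r0 rc; have d0 : (0 < L1' - L1)%R by rewrite subr_gt0.
apply: (@lt_le_trans _ _ (hdev (fun t => pinv_up g1 t%:E + pinv_up g2 t%:E +
    L2%:E) b + ((L1' - L1) / r)%:E + (L1 / c)%:E)).
  rewrite -addeA lteD2lE; last first.
    by apply: Gfin; rewrite lee_fin divr_ge0 ?ltW// (le_lt_trans L10).
  rewrite lte_fin -ltrBlDr -mulrBl ltr_pM2l//.
  by rewrite ltf_pV2.
apply: leeD2r; apply: hdev_regularity_gap => // x x0.
by apply: lipschitz_pinv_down => //; exact: ltW.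
Qed.

End Curves.

Theorem proposition4 (R : realType) (c : R) (Lmin Lmax : bool -> R)
    (c_gt0 : (0 < c)%R)
    (Lmin_Lmax : forall i : bool, (0 <= Lmin i <= Lmax i)%R) :
  let dA := DeltaA c (Lmin flow1) in
  let dG := DeltaG c (Lmax flow1) (Lmax flow2) in
  (* 1. from arrival curves to derived regularity constraints *)
  (let g := fun (alpha : bool -> R -> \bar R) (i : bool) =>
     derived_regularity (Lmin i) (alpha i) in
   (forall (S : trace R) (beta : R -> \bar R) (alpha : bool -> R -> \bar R),
      fifo_system c Lmin Lmax S beta ->
      (forall i : bool, arrival_curve Lmax S i (alpha i)) ->
      let A := dA beta (alpha flow1) (alpha flow2) in
      let G := dG beta (g alpha flow1) (g alpha flow2) in
      [/\ A <= G,
          Lmin flow1 = Lmax flow1 -> Lmin flow2 = Lmax flow2 -> A = G &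
          (Lmin flow1 < Lmax flow1)%R ->
          forall r T : R, (0 < r < c)%R -> (0 <= T)%R ->
          (forall t : R, (0 <= t)%R -> beta t = rate_latency r T t) ->
          A < +oo -> A < G]) /\
   ((Lmin flow1 < Lmax flow1)%R ->
    forall r T : R, (0 < r < c)%R -> (0 <= T)%R ->
    exists (S : trace R) (alpha : bool -> R -> \bar R),
      [/\ fifo_system c Lmin Lmax S (rate_latency r T),
          exists n : nat, packet S n /\ flow S n = flow1,
          forall i : bool, arrival_curve Lmax S i (alpha i) &
          dA (rate_latency r T) (alpha flow1) (alpha flow2)
          < dG (rate_latency r T) (g alpha flow1) (g alpha flow2)])) /\
  (* 2. from regularity constraints to derived arrival curves *)
  (let alpha := fun (g : bool -> R -> \bar R) (i : bool) =>
     derived_arrival (Lmax i) (g i) in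
   (forall (S : trace R) (beta : R -> \bar R) (g : bool -> R -> \bar R),
      fifo_system c Lmin Lmax S beta ->
      (forall i : bool, regularity S i (g i)) ->
      let A := dA beta (alpha g flow1) (alpha g flow2) in
      let G := dG beta (g flow1) (g flow2) in
      [/\ G <= A,
          Lmin flow1 = Lmax flow1 -> A = G &
          (Lmin flow1 < Lmax flow1)%R ->
          forall r T : R, (0 < r < c)%R -> (0 <= T)%R ->
          (forall t : R, (0 <= t)%R -> beta t = rate_latency r T t) ->
          G < +oo -> G < A]) /\
   ((Lmin flow1 < Lmax flow1)%R ->
    forall r T : R, (0 < r < c)%R -> (0 <= T)%R ->
    exists (S : trace R) (g : bool -> R -> \bar R),
      [/\ fifo_system c Lmin Lmax S (rate_latency r T),
          exists n : nat, packet S n /\ flow S n = flow1,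
          forall i : bool, regularity S i (g i) &
          dG (rate_latency r T) (g flow1) (g flow2)
          < dA (rate_latency r T) (alpha g flow1) (alpha g flow2)])).
Proof.
have Lmin0 i : (0 <= Lmin i)%R by have /andP[] := Lmin_Lmax i.
have LmM i : (Lmin i <= Lmax i)%R by have /andP[] := Lmin_Lmax i.
have Lmax0 i : (0 <= Lmax i)%R := le_trans (Lmin0 i) (LmM i).
move=> dA dG; split; split.
- move=> S beta alpha _ arr A G.
  have [F1 _ _ _] := arr flow1; have [F2 _ _ _] := arr flow2.
  have La i : (Lmin i)%:E <= lim (alpha i s @[s --> 0%R^'+]).
    by have [_ _ + _] := arr i; apply: le_trans; rewrite lee_fin.
  have AG : A <= G.
    apply: leeD; first exact: hdev_arrival_le.
    by rewrite lee_fin ler_pM2r ?invr_gt0.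
  split => //.
  + move=> e1 e2; apply/le_anti; rewrite AG /G /dG /DeltaG -e1 -e2.
    by apply: leeD2r; exact: hdev_derived_regularity_le.
  + by move=> L11' r T _ _ _; exact: DeltaA_lt_DeltaG_derived.
- move=> L11' r T rc T0; have /andP[r0 _] := rc.
  exists (single_packet (Lmax flow1)), (fun i => step_curve (Lmax i)%:E); split.
  + exact: single_packet_fifo_system.
  + by exists 0%N.
  + by move=> i; exact: single_packet_arrival_curve.
  apply: DeltaA_lt_DeltaG_derived => //.
  rewrite lte_add_pinfty ?ltry//.
  apply: (@hdev_rate_latency_lt _ _ _ _ (Lmax flow1 + Lmax flow2)) => //.
    exact: addr_ge0.
  move=> t t0; rewrite leeBlDr// (@le_trans _ _ (Lmax flow1 + Lmax flow2)%:E)//.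
    by rewrite EFinD; apply: leeD; rewrite step_curve_le ?lee_fin.
  by rewrite leeDl ?lee_fin.
- move=> S beta g [_ [b0 _ _] lip _] reg A G.
  have [F1 _ _] := reg flow1; have [F2 _ _] := reg flow2.
  have GA : G <= A.
    rewrite /G /A /dG /dA /DeltaG /DeltaA.
    rewrite -[in leLHS](subrK (Lmin flow1) (Lmax flow1)) mulrDl EFinD addeA.
    apply: leeD2r; apply: hdev_regularity_gap => // x x0.
    by apply: lipschitz_pinv_down => //; rewrite subr_ge0.
  split => //.
  + move=> e1; apply/le_anti; rewrite GA andbT /G /A /dG /dA /DeltaG /DeltaA -e1.
    apply: leeD2r; apply: hdev_derived_arrival_le => //.
      by case: F1.
    by case: F2.
  + move=> L11' r T rc T0 bE; apply: (DeltaG_lt_DeltaA_derived _ r) => //.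
    move=> t1 t2 t10 t20; rewrite !bE//; apply: rate_latency_lipschitz => //.
    by have /andP[/ltW -> _] := rc; rewrite /=.
- move=> L11' r T rc T0; have /andP[r0 _] := rc.
  exists (single_packet (Lmax flow1)), (fun i => step_curve +oo); split.
  + exact: single_packet_fifo_system.
  + by exists 0%N.
  + by move=> i; apply: single_packet_regularity; rewrite leey.
  apply: (DeltaG_lt_DeltaA_derived _ r) => //.
  + by have [] := rate_latency_F0inc r T (ltW r0) T0.
  + by apply: rate_latency_lipschitz; rewrite lexx andbT ltW.
  + by apply: step_curve_F0inc; rewrite leey.
  + by apply: step_curve_F0inc; rewrite leey.
  rewrite lte_add_pinfty ?ltry//.
  apply: (@hdev_rate_latency_lt _ _ _ _ (Lmax flow2)) => //.
  move=> t t0; rewrite -[leRHS]add0e leeD2r//.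
  by rewrite -[leRHS]adde0; apply: leeD; exact: pinv_up_step_pinfty.
Qed.
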